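(* There exists a function $g\colon \mathbb{N} \to \mathbb{N}$ such that $\limsup_{n\to\infty} g(n) = \infty$ and such that, for every $n$, the ideal $J_{n,g(n)}$ is generated (as a usual ideal of the polynomial ring $\mathbf{A}_{n,g(n)}$) by $\frac{g(n)(g(n)+1)}{2}$ homogeneous polynomials of degree $2$ which form a regular sequence in $\mathbf{A}_{n,g(n)}$.
   Context: Here $\mathbb{N}=\{1,2,3,\dots\}$. For $n \in \mathbb{N}$ let $\mathbf{A}_n = \mathrm{Sym}(\mathbb{C}^n \otimes \mathbb{C}^\infty)$, identified with the polynomial ring $\mathbb{C}[x_{i,j} \mid 1 \le i \le n,\ j \in \mathbb{N}]$ (with $x_{i,j}$ corresponding to $e_i \otimes e_j$), graded by $\deg x_{i,j} = 1$. The group $\mathrm{GL}_\infty = \bigcup_{k\ge 1} \mathrm{GL}_k(\mathbb{C})$ acts on $\mathbf{A}_n$ by $\mathbb{C}$-algebra automorphisms through its natural action on the factor $\mathbb{C}^\infty$, i.e. $h\cdot x_{i,j} = \sum_k h_{k,j} x_{i,k}$. A $\mathrm{GL}$-ideal of $\mathbf{A}_n$ is an ideal stable under $\mathrm{GL}_\infty$; it is equivariantly generated by $f_1,\dots,f_r$ if it is the smallest $\mathrm{GL}$-ideal containing them. $J_n \subset \mathbf{A}_n$ denotes the $\mathrm{GL}$-ideal equivariantly generated by the single polynomial $x_{1,1}^2 + x_{2,1}^2 + \cdots + x_{n,1}^2$. Viewing $\mathbf{A}_n$ and $J_n$ as polynomial functors of $\mathbb{C}$-vector spaces, set $\mathbf{A}_{n,m}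 = \mathbf{A}_n(\mathbb{C}^m) = \mathrm{Sym}(\mathbb{C}^n\otimes\mathbb{C}^m) = \mathbb{C}[x_{i,j} \mid 1\le i\le n,\ 1 \le j \le m]$ and $J_{n,m} = J_n(\mathbb{C}^m) \subset \mathbf{A}_{n,m}$. Concretely, for $m\ge 1$, $J_{n,m}$ is the smallest ideal of $\mathbf{A}_{n,m}$ that is stable under the natural action of $\mathrm{GL}_m(\mathbb{C})$ (acting on the factor $\mathbb{C}^m$) and contains $x_{1,1}^2 + \cdots + x_{n,1}^2$. *)

(* Defs.v *)
From mathcomp Require Import all_boot all_order all_algebra.
From mathcomp Require Import mpoly complex.
From mathcomp Require Import reals ereal sequences.

Set Implicit Arguments.
Unset Strict Implicit.
Unset Printing Implicit Defensive.

Import GRing.Theory.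
Local Open Scope ring_scope.

Section Ideals.
Variable A : comNzRingType.

Definition is_ideal (I : A -> Prop) : Prop :=
  [/\ I 0, forall a b, I a -> I b -> I (a + b) & forall a b, I b -> I (a * b)].

Definition ideal_of (s : seq A) (a : A) : Prop :=
  exists c : 'I_(size s) -> A, a = \sum_(i < size s) c i * s`_i.

(* [s`_i] is a nonzerodivisor on [A / (s`_0, ..., s`_(i-1))] for every [i],
   and [A / (s) <> 0]. *)
Definition regular_sequence (s : seq A) : Prop :=
  (forall i, (i < size s)%N ->
     forall a, ideal_of (take i s) (a * s`_i) -> ideal_of (take i s) a)
  /\ ~ ideal_of s 1.

End Ideals.

(* [x_{i,j}] is the variable numbered [mxvec_index i j]. *)
Notation polyA C n m := {mpoly C[(n * m)%N]} (only parsing).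

Section GLIdeals.
Variables (C : fieldType) (n m : nat).

Definition xvar (i : 'I_n) (j : 'I_m) : polyA C n m := 'X_(mxvec_index i j).

Definition gl_image (h : 'M[C]_m) : 'M[polyA C n m]_(n, m) :=
  \matrix_(i, j) \sum_(k < m) h k j *: xvar i k.

Definition gl_act (h : 'M[C]_m) (p : polyA C n m) : polyA C n m :=
  comp_mpoly [tuple mxvec (gl_image h) 0 k | k < n * m] p.

Lemma gl_act_xvar (h : 'M[C]_m) (i : 'I_n) (j : 'I_m) :
  gl_act h (xvar i j) = \sum_(k < m) h k j *: xvar i k.
Proof. by rewrite /gl_act comp_mpolyXU -tnth_nth tnth_mktuple mxvecE mxE. Qed.

Definition gl_stable (I : polyA C n m -> Prop) : Prop :=
  forall h : 'M[C]_m, h \in unitmx -> forall p, I p -> I (gl_act h p).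

(* The ideal J_{n,m}, for [m >= 1]. The first column is the
   one with [j = 0] here; for [m = 0] there is no such column. *)
Definition J (p : polyA C n m) : Prop :=
  forall I : polyA C n m -> Prop,
    is_ideal I -> gl_stable I ->
    (forall j : 'I_m, j = 0%N :> nat -> I (\sum_(i < n) xvar i j ^+ 2)) ->
    I p.

End GLIdeals.

(* Main.v *)
From HB Require Import structures.
Require Import Defs.
From mathcomp Require Import all_boot all_order all_fingroup all_algebra.
From mathcomp Require Import mpoly complex.
From mathcomp Require Import reals ereal sequences topology normedtype.
From mathcomp Require Import ring zify.

(** Write [q_jk] for the sum over the rows [i] of [x_ij * x_ik], the product of
    columns [j] and [k] of the generic matrix. The ideal J is generated by the
    [m(m+1)/2] quadrics [q_jk] with [j <= k]: their span is stable under the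
    general linear group, as the group acts on them as on symmetric bilinear
    expressions in the columns, and conversely a stable ideal that contains
    the square of one column contains those of all columns and, by
    polarization, all the [q_jk] ([J_dotps]).

    These quadrics form a regular sequence as soon as the number [n] of rows is
    at least [m(m+1)/2]. Indeed, one can then assign its own row to each pair
    [j <= k], and choose weights of the variables for which the unique heaviest
    monomial of [q_jk] is [x_ij * x_ik] with [i] the row of that pair
    ([pair_weight_max]). These initial monomials involve disjoint sets of
    variables. Polynomials with pairwise coprime initial monomials form a
    Groebner basis of the ideal that they generate, whose initial ideal is
    generated by these monomials ([initial_ideal]); and they form a regular
    sequence because coprime monomials do ([regular_sequence_initial]).

    It remains to take for [g n] the largest [m] with [m(m+1)/2 <= n], which is
    positive for [n > 0] and tends to infinity with [n]. *)

Set Implicit Arguments.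
Unset Strict Implicit.
Unset Printing Implicit Defensive.

Import Order.TTheory GRing.Theory Num.Theory.
Local Open Scope ring_scope.

(** * Finitely generated ideals *)

Section IdealOf.
Variable A : comNzRingType.
Implicit Types (s : seq A) (a b x : A).

Lemma is_ideal_ideal_of s : is_ideal (ideal_of s).
Proof.
split.
- by exists (fun _ => 0); rewrite big1 // => i _; rewrite mul0r.
- move=> _ _ [c ->] [d ->]; exists (fun i => c i + d i).
  by rewrite -big_split /=; apply: eq_bigr => i _; rewrite mulrDl.
- move=> a _ [c ->]; exists (fun i => a * c i).
  by rewrite mulr_sumr; apply: eq_bigr => i _; rewrite mulrA.
Qed.

Lemma ideal_ofD s a b : ideal_of s a -> ideal_of s b -> ideal_of s (a + b).
Proof. by case: (is_ideal_ideal_of s) => _ + _; apply. Qed.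

Lemma ideal_ofMl s a b : ideal_of s b -> ideal_of s (a * b).
Proof. by case: (is_ideal_ideal_of s) => _ _; apply. Qed.

Lemma ideal_ofB s a b : ideal_of s a -> ideal_of s b -> ideal_of s (a - b).
Proof. by move=> sa sb; rewrite -mulN1r; apply/ideal_ofD/ideal_ofMl. Qed.

Lemma ideal_of_nil a : ideal_of [::] a -> a = 0.
Proof. by case=> c ->; rewrite big_ord0. Qed.

Lemma ideal_of_nth s i : (i < size s)%N -> ideal_of s s`_i.
Proof.
move=> lti; exists (fun j : 'I_(size s) => (j == i :> nat)%:R).
rewrite (bigD1 (Ordinal lti)) //= eqxx mul1r big1 ?addr0 // => j.
by rewrite -val_eqE /= => /negbTE ->; rewrite mul0r.
Qed.

Lemma ideal_of_mem s x : x \in s -> ideal_of s x.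
Proof.
by move=> xs; rewrite -[x](nth_index 0 xs); apply: ideal_of_nth; rewrite index_mem.
Qed.

Lemma ideal_of_rcons s x a :
  ideal_of (rcons s x) a -> exists c, ideal_of s (a - c * x).
Proof.
case=> c ->.
(* The coefficients are extended by zero to all of nat, so that the last term
   of the sum can be split off. *)
pose d k := if insub k is Some i then c i else 0.
have -> : \sum_(i < size (rcons s x)) c i * (rcons s x)`_i =
          \sum_(0 <= i < size (rcons s x)) d i * (rcons s x)`_i.
  by rewrite big_mkord; apply: eq_bigr => i _; rewrite /d valK.
rewrite size_rcons big_nat_recr //= nth_rcons ltnn eqxx.
exists (d (size s)), (fun i => d i).
rewrite addrK big_mkord; apply: eq_bigr => i _.
by rewrite nth_rcons ltn_ord.
Qed.

Lemma ideal_sub s (I : A -> Prop) :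
  is_ideal I -> (forall x, x \in s -> I x) -> forall a, ideal_of s a -> I a.
Proof.
move=> [I0 ID IM] Is a [c ->].
apply: (big_ind I) => // i _.
by apply/IM/Is/mem_nth.
Qed.

End IdealOf.

(** * Pairwise coprime initial monomials give regular sequences *)

Section InitialMonomials.
Variables (N : nat) (R : comNzRingType) (mf : measure N).
Local Notation mw := (mmeasure mf).
Implicit Types (a c f p q : {mpoly R[N]}) (m u v : 'X_{1..N}).

Lemma mmeasure_leP p D :
  reflect (forall u, u \in msupp p -> (mf u < D)%N) (mw p <= D)%N.
Proof.
rewrite mmeasureE; apply: (iffP (bigmax_leqP_seq _ _ _ _)) => H u; first by move=> ?; apply: H.
by move=> + _; apply: H.
Qed.

Lemma mmeasureB_le p q D : (mw p <= D)%N -> (mw q <= D)%N -> (mw (p - q) <= D)%N.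
Proof.
move=> hp hq; apply: (leq_trans (mmeasureD_le _ _ _)).
by rewrite mmeasureN geq_max hp.
Qed.

Lemma mmeasureM_le p q D E :
  (mw p <= D.+1)%N -> (mw q <= E)%N -> (mw (p * q) <= D + E)%N.
Proof.
move=> /mmeasure_leP hp /mmeasure_leP hq; apply/mmeasure_leP => u.
move=> /msuppM_le /allpairsP[[u1 u2] /= [/hp h1 /hq h2 ->]].
by rewrite mfD -addnS leq_add.
Qed.

(** All monomials of [f] other than [m] weigh strictly less than [m], and [m]
    has coefficient 1: the initial form of [f] for the weight is ['X_[m]]. *)
Definition initial_monomial f m := (mw (f - 'X_[m]) <= mf m)%N.

Lemma initial_monomial_mmeasure f m : initial_monomial f m -> (mw f <= (mf m).+1)%N.
Proof.
move=> fm; rewrite -[f](subrK 'X_[m]).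
apply: leq_trans (mmeasureD_le _ _ _) _.
by rewrite geq_max mmeasureX leqnn andbT ltnW.
Qed.

(** In top weight a product with [f] is a product with its initial monomial:
    the rest of [f] only contributes to lower weights. *)
Lemma mcoeffM_initial f m c u D :
  initial_monomial f m -> (mw c <= D.+1)%N -> mf u = (D + mf m)%N ->
  (c * f)@_u = (c * 'X_[m])@_u.
Proof.
move=> fm hc hu; rewrite -{1}[f](subrK 'X_[m]) mulrDr mcoeffD.
rewrite [X in X + _]memN_msupp_eq0 ?add0r //.
by apply: (mmeasure_mnm_ge (mf := mf)); rewrite hu; apply: mmeasureM_le.
Qed.

Lemma msuppM_initial f m c u :
  initial_monomial f m -> (mw c <= (mf u).+1)%N -> u \in msupp c ->
  (u + m)%MM \in msupp (c * f).
Proof.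
move=> fm hc uc; rewrite mcoeff_msupp (mcoeffM_initial fm hc) ?mfD //.
by rewrite addmC mcoeffMX -mcoeff_msupp.
Qed.

Variables (s : seq {mpoly R[N]}) (lm : nat -> 'X_{1..N}).
Hypothesis initial_s : forall i, (i < size s)%N -> initial_monomial s`_i (lm i).

(** One step of multivariate division: a top monomial [u] of [c] divisible by
    [lm i] is replaced, using ['X_[u - lm i] * s`_i], by terms of lower
    weight. *)
Lemma reduce_initial k c D : (k <= size s)%N -> (mw c <= D.+1)%N ->
  (forall u, u \in msupp c -> mf u = D ->
     exists2 i, (i < k)%N & (lm i <= u)%MM) ->
  exists2 r, ideal_of (take k s) r & (mw (c - r) <= D)%N.
Proof.
move=> hk /mmeasure_leP hc init_c.
pose Q p := exists2 r, ideal_of (take k s) r & (mw (p - r) <= D)%N.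
have [I0 ID IM] := is_ideal_ideal_of (take k s).
rewrite -/(Q c) [c]mpolyE big_seq; apply: (big_ind Q).
- by exists 0; rewrite // subr0 mmeasure0.
- move=> p q [r Ir hr] [r' Ir' hr']; exists (r + r'); first exact: ID.
  by rewrite opprD addrACA (leq_trans (mmeasureD_le _ _ _)) // geq_max hr.
move=> u uc; have := hc u uc; rewrite ltnS leq_eqVlt => /orP[/eqP uD|uD]; last first.
  exists 0 => //; rewrite subr0 (leq_trans (mmeasureZ_le _ _ _)) //.
  by rewrite mmeasureX.
have [i ik iu] := init_c u uc uD.
have lti := leq_trans ik hk.
exists (c@_u *: 'X_[u - lm i] * s`_i).
  apply: IM; rewrite -(nth_take 0 ik).
  by apply: ideal_of_nth; rewrite size_take_min leq_min ik.
rewrite -scalerAl -scalerBr (leq_trans (mmeasureZ_le _ _ _)) //.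
rewrite -{1}(submK iu) mpolyXD -mulrBr -mmeasureN -mulrN opprB.
have -> : D = (mf (u - lm i)%MM + mf (lm i))%N by rewrite -mfD submK.
by apply: mmeasureM_le; [rewrite mmeasureX | apply: initial_s].
Qed.

Hypothesis coprime_lm : forall i j, (i < j)%N -> (j < size s)%N ->
  forall x, (lm i x == 0)%N || (lm j x == 0)%N.

Lemma lem_coprime i j u : (i < j)%N -> (j < size s)%N ->
  (lm i <= u + lm j)%MM -> (lm i <= u)%MM.
Proof.
move=> ij js /mnm_lepP h; apply/mnm_lepP => x; have := h x.
by rewrite mnmDE; case/orP: (coprime_lm ij js x) => /eqP ->; rewrite ?addn0.
Qed.

(** The elements of [s] form a Groebner basis for the weight: top monomials of
    elements of the ideal are divisible by some [lm i]. In [p = r + c * s`_k],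
    with [r] in the ideal of the earlier elements, either nothing cancels in
    top weight and the claim follows from that for [r], or each top monomial
    of [c], multiplied by [lm k], occurs in [r]; it is then divisible by some
    [lm i] with [i < k], coprime to [lm k], so that the top part of [c] can be
    moved into [r]. *)
Lemma initial_ideal k p u : (k <= size s)%N ->
  ideal_of (take k s) p -> (mw p <= (mf u).+1)%N -> u \in msupp p ->
  exists2 i, (i < k)%N & (lm i <= u)%MM.
Proof.
elim: k p u => [|k IH] p u ks.
  by rewrite take0 => /ideal_of_nil -> _; rewrite msupp0.
have fm := initial_s ks.
rewrite (take_nth 0 ks) => /ideal_of_rcons[c +] hp up.
set f := s`_k in fm *.
have widen v : (exists2 i, (i < k)%N & (lm i <= v)%MM) ->
    exists2 i, (i < k.+1)%N & (lm i <= v)%MM.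
  by case=> i ik iv; exists i => //; apply: ltnW.
(* Induction on the weight of c in p = r + c * f with r in the ideal of the
   first k elements. *)
have [E] := ubnP (mw c).
elim: E c => // E IHE c; rewrite ltnS => hE; set r := p - c * f => Ir.
have [c0|c_neq0] := eqVneq c 0.
  by apply/widen/(IH p) => //; [apply: ltnW | move: Ir; rewrite /r c0 mul0r subr0].
have /esym Dc := mpolySpred mf c_neq0; set D := (mw c).-1 in Dc.
have hcf : (mw (c * f) <= (D + mf (lm k)).+1)%N.
  by rewrite -addnS mmeasureM_le ?Dc // initial_monomial_mmeasure.
have [Du|uD] := leqP (D + mf (lm k)) (mf u).
  (* No cancellation of top weights between r and c * f. *)
  have hr : (mw r <= (mf u).+1)%N.
    by apply: mmeasureB_le => //; apply: leq_trans hcf _.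
  have : u \in msupp (r + c * f) by rewrite subrK.
  move/msuppD_le; rewrite mem_cat => /orP[ur|ucf].
    by apply/widen/(IH r) => //; apply: ltnW.
  exists k => //.
  have lm_u : (mf (lm k) <= mf u)%N by apply: leq_trans Du; apply: leq_addl.
  move: ucf; rewrite mcoeff_msupp (mcoeffM_initial (D := mf u - mf (lm k)) fm).
  - rewrite -mcoeff_msupp (perm_mem (msuppMX _ _)) => /mapP[v _ ->].
    exact: lem_addr.
  - by rewrite -Dc ltnS -(leq_add2r (mf (lm k))) subnK.
  - by rewrite subnK.
(* The top part of c * f is cancelled by that of r, so the induction hypothesis
   on r shows that the top monomials of c can be reduced away. *)
have [v vI hv] : exists2 v, ideal_of (take k s) v & (mw (c - v) <= D)%N.
  apply: reduce_initial; [exact: ltnW | by rewrite Dc | move=> w wc wD].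
  have wf : (w + lm k)%MM \in msupp (c * f).
    by apply: msuppM_initial => //; rewrite wD Dc.
  have [] // := IH r (w + lm k)%MM.
  - exact: ltnW.
  - rewrite mfD wD; apply: mmeasureB_le => //.
    by apply: leq_trans hp _; apply: ltnW.
  - rewrite mcoeff_msupp mcoeffB [p@_ _]memN_msupp_eq0.
      by rewrite sub0r oppr_eq0 -mcoeff_msupp.
    by apply: (mmeasure_mnm_ge (mf := mf)); rewrite mfD wD; apply: leq_trans hp _.
  - by move=> i ik /lem_coprime; exists i => //; auto.
apply: (IHE (c - v)).
  by apply: leq_ltn_trans hv _; rewrite Dc.
rewrite mulrBl opprB addrCA addrC; apply: ideal_ofD => //.
by rewrite mulrC; apply: ideal_ofMl.
Qed.

(** A top monomial [u] of [a] yields the top monomial [u + lm k] of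
    [a * s`_k]; some [lm i] with [i < k] divides it, hence divides [u] by
    coprimality, and [a] can be reduced to lower weight. *)
Lemma nonzerodivisor_initial k a : (k < size s)%N ->
  ideal_of (take k s) (a * s`_k) -> ideal_of (take k s) a.
Proof.
move=> ks; have fm := initial_s ks; have [D] := ubnP (mw a).
elim: D a => // D IH a; rewrite ltnS leq_eqVlt => /orP[/eqP aD|]; last exact: IH.
case: D aD IH => [/eqP|D aD IH Ia].
  by rewrite mmeasure_poly_eq0 => /eqP -> _ _; case: (is_ideal_ideal_of (take k s)).
have [r Ir hr] : exists2 r, ideal_of (take k s) r & (mw (a - r) <= D)%N.
  apply: reduce_initial; [exact: ltnW | by rewrite aD | move=> u ua uD].
  have [] // := @initial_ideal k (a * s`_k) (u + lm k)%MM.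
  - exact: ltnW.
  - rewrite mfD uD -addnS mmeasureM_le ?aD //.
    exact: initial_monomial_mmeasure.
  - by rewrite msuppM_initial // aD uD.
  - by move=> i ik /lem_coprime; exists i => //; auto.
rewrite -[a](subrK r); apply: ideal_ofD => //; apply: IH => //.
by rewrite mulrBl; apply: ideal_ofB => //; rewrite mulrC; apply: ideal_ofMl.
Qed.

Hypothesis lm_neq0 : forall i, (i < size s)%N -> lm i != 0%MM.

Lemma regular_sequence_initial : regular_sequence s.
Proof.
split=> [i lti a|]; first exact: nonzerodivisor_initial.
rewrite -[s]take_size => s1.
have [] := @initial_ideal (size s) 1 0%MM (leqnn _) s1; rewrite ?mmeasure1 //.
  by rewrite msupp1 inE.
move=> i lti /mnm_lepP i0; have /eqP := lm_neq0 lti; apply.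
by apply/mnmP => x; have := i0 x; rewrite mnm0E leqn0 => /eqP.
Qed.

End InitialMonomials.

(** * Weights on the variables of a matrix *)

Section IndexedWeight.
Variables (n m : nat) (w : 'I_n -> 'I_m -> nat).

Definition weight_of (u : 'X_{1..(n * m)}) : nat :=
  (\sum_i \sum_j u (mxvec_index i j) * w i j)%N.

Lemma weight_of0 : weight_of 0%MM = 0%N.
Proof. by rewrite /weight_of big1 // => i _; rewrite big1 // => j _; rewrite mnm0E. Qed.

Lemma weight_ofD : {morph weight_of : u v / (u + v)%MM >-> (u + v)%N}.
Proof.
move=> u v; rewrite /weight_of -big_split /=; apply: eq_bigr => i _.
by rewrite -big_split /=; apply: eq_bigr => j _; rewrite mnmDE mulnDl.
Qed.

HB.instance Definition _ := isMeasure.Build (n * m) weight_of weight_of0 weight_ofD.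

End IndexedWeight.

Lemma mxvec_index_inj n m (i i' : 'I_n) (j j' : 'I_m) :
  (mxvec_index i j == mxvec_index i' j') = (i == i') && (j == j').
Proof.
by rewrite (inj_eq (@cast_ord_inj _ _ _)) (inj_eq enum_rank_inj) xpair_eqE.
Qed.

Lemma weight_ofU n m (w : 'I_n -> 'I_m -> nat) i j :
  weight_of w U_(mxvec_index i j)%MM = w i j.
Proof.
rewrite /weight_of (bigD1 i) //= (bigD1 j) //= mnm1E eqxx mul1n.
rewrite [X in (_ + X + _)%N]big1 ?addn0 => [|j' nj]; last first.
  by rewrite mnm1E mxvec_index_inj eqxx eq_sym (negbTE nj).
rewrite big1 ?addn0 // => i' ni; rewrite big1 // => j' _.
by rewrite mnm1E mxvec_index_inj eq_sym (negbTE ni).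
Qed.

(** * Products of columns and the general linear group *)

Section Quadrics.
Variables (F : fieldType) (n m : nat).
Implicit Types (i : 'I_n) (j k : 'I_m).
Local Notation xvar := (@xvar F n m).

Definition dotp j k : polyA F n m := \sum_(i < n) xvar i j * xvar i k.

Definition xmnm i j k : 'X_{1..(n * m)} :=
  (U_(mxvec_index i j) + U_(mxvec_index i k))%MM.

Lemma dotpE j k : dotp j k = \sum_i 'X_[xmnm i j k].
Proof. by apply: eq_bigr => i _; rewrite mpolyXD. Qed.

Lemma dotpC j k : dotp j k = dotp k j.
Proof. by apply: eq_bigr => i _; rewrite mulrC. Qed.

Lemma dotp_homog j k : dotp j k \is 2.-homog.
Proof. by rewrite dotpE rpred_sum // => i _; rewrite dhomogX /= mdegD !mdeg1. Qed.

Lemma initial_dotp (w : 'I_n -> 'I_m -> nat) i j k :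
  (0 < w i j + w i k)%N ->
  (forall i', i' != i -> w i' j + w i' k < w i j + w i k)%N ->
  initial_monomial (weight_of w) (dotp j k) (xmnm i j k).
Proof.
move=> w_gt0 w_max; rewrite /initial_monomial dotpE (bigD1 i) //= addrAC subrr add0r.
apply: (leq_trans (mmeasure_sum _ _ _ _)); apply/bigmax_leqP => i' ne_i.
by rewrite mmeasureX !mfD /= !weight_ofU w_max.
Qed.

Lemma gl_act_dotp_sum (h : 'M[F]_m) j k :
  gl_act h (dotp j k) = \sum_i gl_act h (xvar i j) * gl_act h (xvar i k).
Proof.
rewrite /gl_act /dotp rmorph_sum /=.
by apply: eq_bigr => i _; rewrite rmorphM.
Qed.

Lemma gl_act_dotp (h : 'M[F]_m) j k :
  gl_act h (dotp j k) = \sum_l \sum_l' (h l j * h l' k)%:MP * dotp l l'.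
Proof.
rewrite gl_act_dotp_sum; under eq_bigr do rewrite !gl_act_xvar mulr_suml.
rewrite exchange_big; apply: eq_bigr => l _ /=.
under eq_bigr do rewrite mulr_sumr.
rewrite exchange_big; apply: eq_bigr => l' _ /=.
rewrite mulr_sumr; apply: eq_bigr => i _.
by rewrite -scalerAl -scalerAr scalerA mul_mpolyC.
Qed.

(** A transposition of columns carries the first column to any other one. *)
Lemma gl_stable_square (I : polyA F n m -> Prop) :
  gl_stable I -> (forall j, j = 0%N :> nat -> I (dotp j j)) ->
  forall j, I (dotp j j).
Proof.
move=> GI Isq0 j.
pose j0 : 'I_m := Ordinal (leq_ltn_trans (leq0n j) (ltn_ord j)).
pose h : 'M[F]_m := perm_mx (tperm j0 j).
have x_h i : gl_act h (xvar i j0) = xvar i j.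
  rewrite gl_act_xvar (bigD1 j) //= big1 ?addr0 => [|l ne_lj].
    by rewrite !mxE tpermR eqxx scale1r.
  by rewrite !mxE -{2}(tpermR j0 j) (inj_eq perm_inj) (negbTE ne_lj) scale0r.
have -> : dotp j j = gl_act h (dotp j0 j0).
  by rewrite gl_act_dotp_sum; apply: eq_bigr => i _; rewrite x_h.
by apply: GI; [apply: unitmx_perm | apply: Isq0].
Qed.

(** Polarization: adding column [k] to column [j] turns the square of column
    [j] into the sum of both squares and twice the mixed product. *)
Lemma gl_ideal_dotp (I : polyA F n m -> Prop) :
  2%:R != 0 :> F -> is_ideal I -> gl_stable I ->
  (forall j, I (dotp j j)) -> forall j k, I (dotp j k).
Proof.
move=> two_neq0 [I0 ID IM] GI Isq j k.
have [->|ne_jk] := eqVneq j k; first exact: Isq.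
pose h : 'M[F]_m := 1%:M + delta_mx k j.
have h_unit : h \in unitmx.
  suff /mulmx1_unit[] : h *m (1%:M - delta_mx k j) = 1%:M by [].
  rewrite mulmxDl mulmxBr mulmx1 mul1mx mulmxBr mulmx1 mul_delta_mx_0 //.
  by rewrite subr0 subrK.
have x_h i : gl_act h (xvar i j) = xvar i j + xvar i k.
  rewrite gl_act_xvar (bigD1 j) //= (bigD1 k) 1?eq_sym //= big1 ?addr0.
    by rewrite !mxE !eqxx (negbTE ne_jk) eq_sym (negbTE ne_jk) addr0 add0r !scale1r.
  move=> l /andP[lj lk].
  by rewrite !mxE (negbTE lj) (negbTE lk) addr0 scale0r.
have act_h : gl_act h (dotp j j) = dotp j j + dotp k k + 2%:R *: dotp j k.
  rewrite gl_act_dotp_sum scaler_sumr -!big_split; apply: eq_bigr => i _ /=.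
  rewrite x_h scaler_nat -mulr_natl.
  by ring.
have -> : dotp j k =
    (2%:R^-1)%:MP * (gl_act h (dotp j j) + (-1) * (dotp j j + dotp k k)).
  by rewrite act_h mulN1r addrC addKr mul_mpolyC scalerA mulVf // scale1r.
by apply/IM/ID; [apply: GI | apply/IM/ID].
Qed.

End Quadrics.

(** * Unordered pairs of columns *)

Section Pairs.
Variable m : nat.
Implicit Types (j k : 'I_m) (p q : 'I_m * 'I_m).

Definition ord_pairs : seq ('I_m * 'I_m) :=
  enum [pred p : 'I_m * 'I_m | (p.1 <= p.2)%N].

Lemma mem_ord_pairs p : (p \in ord_pairs) = (p.1 <= p.2)%N.
Proof. by rewrite mem_enum. Qed.

Lemma size_ord_pairs : size ord_pairs = ((m * m.+1) %/ 2)%N.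
Proof.
rewrite -cardE -sum1_card (eq_bigl (fun p : 'I_m * 'I_m => true && (p.1 <= p.2)%N)) //.
rewrite -(pair_big_dep (fun=> true) (fun j k : 'I_m => (j <= k)%N) (fun _ _ => 1%N)) /=.
rewrite (exchange_big_dep (fun=> true)) //=.
have -> : (m * m.+1 %/ 2)%N = (\sum_(0 <= i < m.+1) i)%N.
  by rewrite divn2 triangular_sum bin2 mulnC.
rewrite big_nat_recl // add0n big_mkord; apply: eq_bigr => k _.
rewrite -[RHS]card_ord -sum1_card.
exact/esym/(big_ord_widen m (fun=> 1%N) (ltn_ord k)).
Qed.

(** The weight of column [j] in the row assigned to the pair [p]: 4 if [p] is
    [(j, j)], 3 if [j] is one of two distinct entries of [p], and 0 otherwise.
    The diagonal needs the larger value: otherwise the square of column [j]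
    would be as heavy in a row assigned to [(j, k)] as in its own row. *)
Definition pair_weight p j : nat :=
  ((p.1 == j) + (p.2 == j) + 2 * ((p.1 == j) || (p.2 == j)))%N.

Lemma pair_weight_gt0 p : (0 < pair_weight p p.1)%N.
Proof. by rewrite /pair_weight eqxx. Qed.

Lemma pair_weight_max p q : p \in ord_pairs -> q \in ord_pairs -> q != p ->
  (pair_weight q p.1 + pair_weight q p.2 < pair_weight p p.1 + pair_weight p p.2)%N.
Proof.
rewrite !mem_ord_pairs; case: p q => [j k] [j' k'] /= jk jk'.
rewrite xpair_eqE /pair_weight /= !eqxx -!val_eqE /=.
move: (val j) (val k) (val j') (val k') jk jk' => {j k j' k'} j k j' k'.
do 5?[case: eqVneq => ? //=; subst]; lia.
Qed.

End Pairs.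

(** * The ideal of all products of columns *)

Section DotProducts.
Variable F : fieldType.

Definition dotps n m : seq (polyA F n m) :=
  [seq dotp F n p.1 p.2 | p <- ord_pairs m].

Lemma mem_dotps n m j k : dotp F n j k \in dotps n m.
Proof.
have [jk|/ltnW kj] := leqP j k.
  by apply/mapP; exists (j, k); rewrite ?mem_ord_pairs.
by apply/mapP; exists (k, j); [rewrite mem_ord_pairs | apply: dotpC].
Qed.

Lemma gl_stable_dotps n m : gl_stable (ideal_of (dotps n m)).
Proof.
move=> h _ _ [c ->].
have [I0 ID IM] := is_ideal_ideal_of (dotps n m).
have act_dotp j k : ideal_of (dotps n m) (gl_act h (dotp F n j k)).
  rewrite gl_act_dotp.
  apply: (big_ind (ideal_of _)) => // l _; apply: (big_ind (ideal_of _)) => // l' _.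
  exact/IM/ideal_of_mem/mem_dotps.
rewrite /gl_act rmorph_sum; apply: (big_ind (ideal_of _)) => // i _.
rewrite rmorphM; apply: IM.
have /mapP[[j k] _ ->] := mem_nth 0 (ltn_ord i).
exact: act_dotp.
Qed.

Lemma J_dotps n m (p : polyA F n m) :
  2%:R != 0 :> F -> J p <-> ideal_of (dotps n m) p.
Proof.
move=> two_neq0; split=> [|Ip I I_ideal GI Isq].
  apply; [exact: is_ideal_ideal_of | exact: gl_stable_dotps | move=> j _].
  exact: (ideal_of_mem (mem_dotps n j j)).
move: p Ip; apply: ideal_sub => // _ /mapP[[j k] _ ->].
by apply: gl_ideal_dotp => //; apply: gl_stable_square.
Qed.

(** There is a row for each pair of columns. With the weights of
    [pair_weight], the product of columns [j] and [k] has as initial monomial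
    its term in the row of the pair [(j, k)]; monomials from distinct rows are
    coprime. *)
Lemma regular_dotps n m :
  (m * m.+1 %/ 2 <= n)%N -> regular_sequence (dotps n m).
Proof.
rewrite -size_ord_pairs /dotps => le_n.
have [s0|size_gt0] := posnP (size (ord_pairs m)).
  rewrite (size0nil s0) /=; split=> // /ideal_of_nil /eqP.
  by rewrite oner_eq0.
set P := ord_pairs m in le_n size_gt0 *.
have p0 : 'I_m * 'I_m by case: P size_gt0 {le_n}.
(* [p0] and [i0] are default values only. *)
pose i0 : 'I_n := Ordinal (leq_trans size_gt0 le_n).
pose pr k := nth p0 P k; pose row k : 'I_n := insubd i0 k.
have rowE k : (k < size P)%N -> row k = k :> nat.
  by move=> kP; rewrite val_insubd (leq_trans kP le_n).
pose w (i : 'I_n) j := if (i < size P)%N then pair_weight (pr i) j else 0%N.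
pose lm k := xmnm (row k) (pr k).1 (pr k).2.
have row_inj i k : (i < size P)%N -> (k < size P)%N -> row i = row k -> i = k.
  by move=> iP kP ik; rewrite -(rowE i) // -(rowE k) // ik.
apply: (@regular_sequence_initial _ _ (weight_of w) _ lm); rewrite size_map.
- move=> k kP; rewrite (nth_map p0) // -/(pr k).
  have w_row j : w (row k) j = pair_weight (pr k) j by rewrite /w rowE // kP.
  have w_gt0 : (0 < w (row k) (pr k).1 + w (row k) (pr k).2)%N.
    by rewrite w_row addn_gt0 pair_weight_gt0.
  apply: initial_dotp => // i ne_i.
  have [iP|iP] := ltnP i (size P); last first.
    have w_i j : w i j = 0%N by rewrite /w ltnNge iP.
    by rewrite !w_i.
  rewrite !w_row /w iP pair_weight_max ?mem_nth //.
  rewrite nth_uniq ?enum_uniq //; apply: contra ne_i => /eqP ik.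
  by rewrite -val_eqE /= rowE // ik.
- move=> i k ik kP x; case: (mxvec_indexP x) => a b.
  have ne_row : row i != row k.
    apply/eqP => /(row_inj _ _ (ltn_trans ik kP) kP) eq_ik.
    by rewrite eq_ik ltnn in ik.
  rewrite /lm /xmnm !mnmDE !mnm1E !mxvec_index_inj.
  have [ra|] := eqVneq (row i) a; last by [].
  by rewrite -ra [row k == _]eq_sym (negbTE ne_row) orbT.
- move=> k _; apply/eqP => /(congr1 mdeg).
  by rewrite mdegD !mdeg1 mdeg0.
Qed.

End DotProducts.

(** * The theorem *)

Definition max_columns n : nat :=
  \max_(m < n.+1 | (m * m.+1 %/ 2 <= n)%N) m.

Lemma max_columns_triangular n :
  (max_columns n * (max_columns n).+1 %/ 2 <= n)%N.
Proof.
have [|m m_n max_m] := @eq_bigmax_cond 'I_n.+1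
  (fun m : 'I_n.+1 => m * m.+1 %/ 2 <= n)%N (@nat_of_ord n.+1).
  by apply/card_gt0P; exists ord0.
by rewrite /max_columns max_m.
Qed.

Lemma leq_max_columns m n : (m * m.+1 %/ 2 <= n)%N -> (m <= max_columns n)%N.
Proof.
move=> mn.
have lt_m : (m < n.+1)%N.
  rewrite ltnS (leq_trans _ mn) // leq_divRL //.
  by case: m {mn} => // m; rewrite leq_mul2l.
exact: (@leq_bigmax_cond _ _ (@nat_of_ord n.+1) (Ordinal lt_m)).
Qed.

Theorem theorem1p2 (R : realType) :
  exists g : nat -> nat,
    [/\ forall n : nat, (0 < n)%N -> (0 < g n)%N,
        limn_esup (fun n : nat => ((g n)%:R : R)%:E) = +oo%E
      & forall n : nat, (0 < n)%N ->
          exists s : seq (polyA R[i] n (g n)),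
            [/\ size s = ((g n * (g n).+1) %/ 2)%N,
                forall f, f \in s -> f \is 2.-homog,
                forall p : polyA R[i] n (g n), J p <-> ideal_of s p
              & regular_sequence s]].
Proof.
exists max_columns; split.
- by move=> n n_gt0; apply: leq_max_columns.
- (* The function even tends to infinity. *)
  refine (snd (cvg_limn_einf_sup _)); apply/cvgeyPge => A.
  pose k := (Num.trunc A).+1.
  exists (k * k.+1 %/ 2)%N => // n /= kn.
  rewrite lee_fin (le_trans (ltW (truncnS_gt A))) // ler_nat.
  exact: leq_max_columns.
- move=> n _; exists (dotps R[i] n (max_columns n)); split.
  + by rewrite size_map size_ord_pairs.
  + by move=> _ /mapP[p _ ->]; apply: dotp_homog.
  + by move=> p; apply: J_dotps; rewrite pnatr_eq0.
  + exact/regular_dotps/max_columns_triangular.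
Qed.
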